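(* Let $\psi\in\Psi$. There is a constant $C=C(\psi)\in(0,\infty)$ such that if a random variable $\xi$ has Orlicz norm $\|\xi\|_{L N[\psi]}=K\in(0,\infty)$, then $$T_\xi(y)\le\exp\left(-h^*[\psi]\left(\ln\frac{y}{C\,K}\right)\right),\quad y\ge e\cdot K.$$
   Context: All random variables are real-valued and defined on a probability space $(\Omega,B,\mathbf{P})$ with expectation $\mathbf{E}$. The tail function is $T_\xi(u)=\max\{\mathbf{P}(\xi>u),\mathbf{P}(\xi<-u)\}$, $u\ge0$. $\Psi$ is the set of continuous functions $\psi:[1,\infty)\to(0,\infty)$ with $\inf_{p\ge1}\psi(p)>0$ such that $h[\psi](p)=p\ln\psi(p)$ is convex on $[1,\infty)$. The Young-Fenchel transform is $h^*[\psi](y)=\sup_{p\in[1,\infty)}(py-h[\psi](p))$. The Young-Orlicz function $N[\psi]$ is $N[\psi](u)=\exp\left(h^*[\psi](\ln|u|)\right)$ for $|u|\ge e$ and $N[\psi](u)=C_0u^2$ for $|u|<e$, where $C_0>0$ is a constant. The Orlicz norm is $\|\xi\|_{L N[\psi]}=\inf\{k>0:\mathbf{E}\,N[\psi](\xi/k)\le1\}$. *)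

(* Defs.v *)
From HB Require Import structures.
From mathcomp Require Import all_boot all_order all_algebra.
From mathcomp Require Import all_classical all_reals all_analysis.
Set Implicit Arguments.
Unset Strict Implicit.
Unset Printing Implicit Defensive.
Import Order.TTheory GRing.Theory Num.Theory.
Import numFieldNormedType.Exports.
Local Open Scope classical_set_scope.
Local Open Scope ring_scope.

Definition tail {d : measure_display} {Omega : measurableType d} {R : realType}
    (P : probability Omega R) (xi : Omega -> R) (u : R) : \bar R :=
  maxe (P [set w | u < xi w]) (P [set w | xi w < - u]).

Definition h {R : realType} (psi : R -> R) (p : R) : R := p * ln (psi p).

(* Functions on [1, +oo) are represented by functions on R; their values
   below 1 are never used. *)
Definition Psi {R : realType} : set (R -> R) := [set psi : R -> R |
  [/\ {within `[1, +oo[, continuous psi},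
      forall p : R, 1 <= p -> 0 < psi p,
      0 < inf (psi @` `[1, +oo[) &
      convex_function (`[1, +oo[%classic : set R^o) (h psi)]].

(* The supremum may be +oo (e.g. when psi is bounded and y is large). *)
Definition hstar {R : realType} (psi : R -> R) (y : R) : \bar R :=
  ereal_sup [set (p * y - h psi p)%:E | p in `[1%R, +oo[].

Definition young_orlicz {R : realType} (C0 : R) (psi : R -> R) (u : R) :
    \bar R :=
  if expR 1 <= `|u| then expeR (hstar psi (ln `|u|)) else (C0 * u ^+ 2)%:E.

(* The expectation is written as an integral since N[psi] may take the value
   +oo; the infimum of the empty set is +oo. *)
Definition orlicz_norm {d : measure_display} {Omega : measurableType d}
    {R : realType} (P : probability Omega R) (N : R -> \bar R)
    (xi : Omega -> R) : \bar R :=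
  ereal_inf [set k%:E | k in
    [set k : R | 0 < k /\ (\int[P]_w N (xi w / k)%R <= 1)%E]].

(* Main.v *)
Require Import Defs.
From HB Require Import structures.
From mathcomp Require Import all_boot all_order all_algebra.
From mathcomp Require Import all_classical all_reals all_analysis.
Import Order.TTheory GRing.Theory Num.Theory.
Import numFieldNormedType.Exports HBNNSimple.
Set Implicit Arguments.
Unset Strict Implicit.
Unset Printing Implicit Defensive.
Local Open Scope classical_set_scope.
Local Open Scope ring_scope.

(** The estimate is Markov's inequality for the Young-Orlicz function [N].  If
    [k] is admissible in the infimum defining the norm, that is
    [E N(xi / k) <= 1], and [y / k >= e], then on [{|xi| > y}] the integrand is
    at least [exp (hstar (ln (y / k)))] because [hstar] is nondecreasing; hence
    [P (|xi| > y) <= exp (- hstar (ln (y / k)))]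
    ([prob_le_of_luxemburg_scale]).

    The norm [K] itself need not be admissible, so the constant [C] has to
    absorb the passage from [K] to a slightly larger admissible [k].  For
    [y > e K] some admissible [k] lies below both [y / e] and [C K] as soon as
    [C > 1], and monotonicity of [hstar] replaces [k] by [C K].  At the endpoint
    [y = e K] there is no room left for [k]; there [C >= e / inf psi] makes
    [hstar (ln (y / (C K))) <= 0] ([hstar_le0]), so the right-hand side is at
    least [1].  The choice [C = 2 + e / inf psi] serves both purposes. *)

(** Comparing [f] from below with a simple function only uses the definition of
    the integral as a supremum, so [f] is allowed to be non-measurable; this
    spares a study of the regularity of the Young-Orlicz function. *)
Lemma markov_nonmeasurable (d : measure_display) (T : measurableType d)
    (R : realType) (mu : {measure set T -> \bar R}) (A : set T)
    (f : T -> \bar R) (r : R) :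
  measurable A -> 0 <= r -> (forall x, (0 <= f x)%E) ->
  (forall x, A x -> (r%:E <= f x)%E) ->
  (r%:E * mu A <= \int[mu]_x f x)%E.
Proof.
move=> mA r0 f0 rf.
pose g := scale_nnsfun (indic_nnsfun R mA) r0.
have gE x : g x = r * \1_A x by [].
have -> : (r%:E * mu A = \int[mu]_x (g x)%:E)%E.
  under eq_integral do rewrite gE EFinM.
  rewrite ge0_integralZl //; last exact/measurable_realfun.measurable_EFinP.
  by rewrite integral_indic // setIT.
rewrite integral_nnsfun // patch_setT ge0_integralTE //.
apply: ereal_sup_ubound; exists g => // x.
rewrite gE indicE; case: (boolP (x \in A)) => [|_].
  by rewrite inE mulr1 => /rf.
by rewrite mulr0.
Qed.

(** The exponential Markov inequality with an extended exponent.  For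
    [a = +oo] it says that a set on which a function of integral at most [1] is
    infinite must be negligible. *)
Lemma measure_le_expeRN (d : measure_display) (T : measurableType d)
    (R : realType) (mu : {measure set T -> \bar R}) (A : set T)
    (f : T -> \bar R) (a : \bar R) :
  measurable A -> (forall x, (0 <= f x)%E) -> (\int[mu]_x f x <= 1)%E ->
  (forall x, A x -> (expeR a <= f x)%E) ->
  (mu A <= expeR (- a))%E.
Proof.
move=> mA f0 f1 af.
have markov r : 0 < r -> (r%:E <= expeR a)%E -> (mu A <= (r^-1)%:E)%E.
  move=> r0 ra.
  have rA : (r%:E * mu A <= 1)%E.
    apply: le_trans f1; apply: markov_nonmeasurable => //; first exact: ltW.
    by move=> x /af; exact: le_trans.
  by rewrite -[(r^-1)%:E]mule1 lee_pdivlMl.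
case: a af markov => [a| |] _ markov /=.
- by rewrite expRN; apply: markov => //; exact: expR_gt0.
- apply/lee_addgt0Pr => e e0; rewrite add0e -[e]invrK.
  by apply: markov; rewrite ?invr_gt0 // leey.
- by rewrite leey.
Qed.

Lemma hstar_mono (R : realType) (psi : R -> R) (x y : R) :
  x <= y -> (hstar psi x <= hstar psi y)%E.
Proof.
move=> xy; apply: ge_ereal_sup => _ [p /= p1 <-].
apply: (@le_trans _ _ (p * y - h psi p)%:E).
  rewrite lee_fin lerD2r ler_wpM2l //.
  by move: p1; rewrite in_itv /= andbT; exact: le_trans.
by apply: ereal_sup_ubound; exists p.
Qed.

(** Below the logarithm of a lower bound [m] of [psi], every term
    [p (y - ln (psi p))] of the supremum is nonpositive. *)
Lemma hstar_le0 (R : realType) (psi : R -> R) (m y : R) :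
  0 < m -> (forall p, 1 <= p -> m <= psi p) -> y <= ln m ->
  (hstar psi y <= 0)%E.
Proof.
move=> m0 mpsi ym; apply: ge_ereal_sup => _ [p /= + <-].
rewrite in_itv /= andbT => p1.
rewrite lee_fin /h -mulrBr mulr_ge0_le0 ?(le_trans _ p1) // subr_le0.
apply: le_trans ym _; rewrite ler_ln ?mpsi // posrE //.
exact: lt_le_trans m0 (mpsi _ p1).
Qed.

Lemma young_orlicz_ge0 (R : realType) (C0 : R) (psi : R -> R) (u : R) :
  0 <= C0 -> (0 <= young_orlicz C0 psi u)%E.
Proof.
move=> C00; rewrite /young_orlicz; case: ifP => _; first exact: expeR_ge0.
by rewrite lee_fin mulr_ge0 // sqr_ge0.
Qed.

Lemma prob_le_of_luxemburg_scale (R : realType) (psi : R -> R) (C0 : R)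
    (d : measure_display) (Omega : measurableType d)
    (P : probability Omega R) (xi : Omega -> R) (k y : R) (A : set Omega) :
  0 <= C0 -> 0 < k -> (\int[P]_w young_orlicz C0 psi (xi w / k) <= 1)%E ->
  expR 1 <= y / k -> measurable A -> (forall w, A w -> y <= `|xi w|) ->
  (P A <= expeR (- hstar psi (ln (y / k))))%E.
Proof.
move=> C00 k0 Nk yk mA yA.
apply: (@measure_le_expeRN _ _ _ _ _
  (fun w => young_orlicz C0 psi (xi w / k))) => //.
  by move=> w; exact: young_orlicz_ge0.
move=> w Aw.
have yxi : y / k <= `|xi w / k|.
  by rewrite normrM normfV (gtr0_norm k0) ler_wpM2r ?yA // invr_ge0 ltW.
rewrite /young_orlicz (le_trans yk yxi) lee_expeR; apply: hstar_mono.
have yk0 : 0 < y / k := lt_le_trans (expR_gt0 1) yk.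
by rewrite ler_ln // posrE // (lt_le_trans yk0).
Qed.

Theorem proposition5p1 (R : realType) (psi : R -> R) (Hpsi : Psi psi) :
  exists2 C : R, 0 < C &
    forall (C0 : R) (d : measure_display) (Omega : measurableType d)
      (P : probability Omega R) (xi : {RV P >-> R}) (K : R),
      0 < C0 -> 0 < K ->
      orlicz_norm P (young_orlicz C0 psi) xi = K%:E ->
      forall y : R, expR 1 * K <= y ->
        (tail P xi y <= expeR (- hstar psi (ln (y / (C * K)))))%E.
Proof.
case: Hpsi => _ psi_gt0; set m := inf _ => m0 _.
have m_le p : 1 <= p -> m <= psi p.
  move=> p1; apply: ge_inf; last by exists p => //=; rewrite in_itv /= andbT.
  exists 0 => _ [q /= + <-]; rewrite in_itv /= andbT => /psi_gt0; exact: ltW.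
pose C := 2 + expR 1 / m.
have em0 : 0 < expR 1 / m by rewrite divr_gt0 // expR_gt0.
have C0' : 0 < C by rewrite addr_gt0.
exists C => // C0 d Omega P xi K C00 K0 normK y.
have mgt : measurable [set w | y < xi w].
  have := measurable_funPT xi measurableT `]y, +oo[%classic (measurable_itv _).
  by rewrite setTI preimage_itvoy.
have mlt : measurable [set w | xi w < - y].
  have := measurable_funPT xi measurableT `]-oo, - y[%classic
    (measurable_itv _).
  by rewrite setTI preimage_itvNyo.
have CK0 : 0 < C * K by rewrite mulr_gt0.
rewrite le_eqVlt => /predU1P[yE|Ky].
- apply: (@le_trans _ _ 1%E).
    by rewrite /tail ge_max !probability_le1.
  rewrite -yE -expeR0 lee_expeR oppe_ge0; apply: (@hstar_le0 _ _ m) => //.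
  rewrite -mulf_div divff ?gt_eqF // mulr1.
  rewrite ler_ln ?posrE ?divr_gt0 ?expR_gt0 // ler_pdivrMr //.
  by rewrite -ler_pdivrMl // mulrC lerDr.
have y0 : 0 < y by apply: lt_trans Ky; rewrite mulr_gt0 // expR_gt0.
have [k [k0 Nk kCK ky]] : exists k, [/\ 0 < k,
    (\int[P]_w young_orlicz C0 psi (xi w / k) <= 1)%E, k <= C * K &
    expR 1 <= y / k].
  have : (orlicz_norm P (young_orlicz C0 psi) xi <
          (Num.min (C * K) (y / expR 1))%:E)%E.
    rewrite normK lte_fin lt_min ltr_pdivlMr ?expR_gt0 // [K * _]mulrC Ky andbT.
    by rewrite ltr_pMl // /C -[ltLHS]addr0 ltrD // ltr1n.
  move=> /ereal_inf_lt[_ [k [k0 Nk] <-]].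
  rewrite lte_fin lt_min => /andP[kCK ky].
  exists k; split => //; first exact: ltW.
  by rewrite ler_pdivlMr // mulrC -ler_pdivlMr ?expR_gt0 // ltW.
have bound A : measurable A -> (forall w, A w -> y <= `|xi w|) ->
    (P A <= expeR (- hstar psi (ln (y / (C * K)))))%E.
  move=> mA yA.
  apply: le_trans (prob_le_of_luxemburg_scale (ltW C00) k0 Nk ky mA yA) _.
  rewrite lee_expeR leeN2; apply: hstar_mono.
  by rewrite ler_ln ?posrE ?divr_gt0 // ler_pM2l // lef_pV2.
rewrite /tail ge_max; apply/andP; split; apply: bound => // w /= yw.
- exact: le_trans (ltW yw) (ler_norm _).
- by rewrite -normrN; apply: le_trans (ler_norm _); rewrite lerNr ltW.
Qed.
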